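(* Let $V$ be a finite-dimensional complex vector space and $W<\mathrm{GL}(V)$ an irreducible reflection group. Let $\mathcal{A}$ be the arrangement of the hyperplanes fixed by the reflections of $W$ and $X=V\setminus\bigcup\mathcal{A}$. Suppose that one of the following holds: (i) $W$ has rank $2$, i.e. $\dim V=2$; (ii) $W$ is one of the exceptional groups $G_{23}=H_3$, $G_{24}$, $G_{25}$, $G_{26}$, $G_{30}=H_4$, $G_{32}$, $G_{33}$, $G_{35}=E_6$. Then for every finite-dimensional complex linear representation $U$ of $W$, the quotient complex vector bundle $(X\times U)/W\to X/W$ (with $W$ acting diagonally on $X\times U$) is topologically trivial.
   Context: A reflection group is a finite subgroup $W<\mathrm{GL}(V)$ generated by (pseudo-)reflections, i.e. by finite-order endomorphisms fixing some hyperplane pointwise; it is irreducible if $W$ acts irreducibly on $V$. The groups $G_{k}$, $4\le k\le 37$, are the exceptional irreducible complex reflection groups in the Shephard-Todd classification, in their reflection representation. The bundles $(X\times U\to X)/W$ are called generalized KZ-bundles. *)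

(* Defs.v *)
From HB Require Import structures.
From mathcomp Require Import all_boot all_order all_algebra all_fingroup.
From mathcomp Require Import generic_quotient mxrepresentation.
From mathcomp Require Export complex.
From mathcomp Require Import all_classical all_reals all_analysis.

Set Implicit Arguments.
Unset Strict Implicit.
Unset Printing Implicit Defensive.

Import Order.TTheory GRing.Theory Num.Theory GroupScope.
Import numFieldNormedType.Exports.

Local Open Scope classical_set_scope.
Local Open Scope quotient_scope.
Local Open Scope complex_scope.
Local Open Scope ring_scope.

(* The usual topology of the complex numbers, given by the modulus. *)
#[non_forgetful_inheritance]
HB.instance Definition _ (R : realType) := NormedModule.copy R[i] R[i]^o.

Section ReflectionGroup.
Context (F : fieldType) (gT : finGroupType) (W : {group gT}) (n : nat).
Variable rV : mx_representation F W n.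

(* Being a hyperplane forces the fixed space to be proper, so the identity is
   not a reflection. Finite order is automatic since W is finite. *)
Definition reflections : {set gT} :=
  [set w in W | (\rank (eigenspace (rV w) 1)).+1 == n]%SET.

Definition irreducible_reflection_group : Prop :=
  [/\ mx_faithful rV, <<reflections>> = W & mx_irreducible rV].

Definition arrangement : set (set 'rV[F]_n) :=
  [set [set v | v *m rV w = v] | w in [set` reflections]].

Definition arrangement_complement : set 'rV[F]_n :=
  ~` \bigcup_(H in arrangement) H.

(* W is generated by reflections s_0, ..., s_(k-1) whose roots alpha_0, ...,
   alpha_(k-1) (the rows of alpha) form a basis of V, with
     s_i (alpha_j) = alpha_j - C_ij alpha_i.
   This determines the image of W in GL(V) up to conjugacy. *)
Definition has_cartan_matrix (k : nat) (C : 'M[F]_k) : Prop :=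
  exists (alpha : 'M[F]_(k, n)) (s : 'I_k -> gT),
    [/\ row_free alpha, row_full alpha,
        <<[set s i | i : 'I_k]%SET>> = W
      & forall i j,
          row j alpha *m rV (s i) = row j alpha - C i j *: row i alpha].

End ReflectionGroup.

(* Cartan matrices of the exceptional groups: s_i has the eigenvalue
   1 - C_ii, i.e. order 2 if C_ii = 2 and order 3 if C_ii = 1 - omega.
   Off the diagonal the matrices encode the Coxeter-like diagrams
     G23 = H3   2 -5- 2 --- 2
     G24        triangle 2, 2, 2 with edges 3, 3, 4
     G25        3 --- 3 --- 3
     G26        2 -4- 3 --- 3
     G30 = H4   2 -5- 2 --- 2 --- 2
     G32        3 --- 3 --- 3 --- 3
     G33        triangle on nodes 1, 2, 3 with node 0 attached to 1 and
                node 4 attached to 3, all of order 2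
     G35 = E6   Bourbaki's labelling
   Replacing an irrationality by a Galois conjugate yields a conjugate
   subgroup of GL(V). *)
Section CartanMatrices.
Variable C : numClosedFieldType.

Definition golden : C := (1 + sqrtC 5) / 2.
Definition omega : C := (-1 + 'i * sqrtC 3) / 2.
Definition alpha7 : C := (1 + 'i * sqrtC 7) / 2.

Definition mx_of_seqs (k : nat) (s : seq (seq C)) : 'M[C]_k :=
  \matrix_(i, j) (nth [::] s i)`_j.

Definition cartan_G23 : 'M[C]_3 := mx_of_seqs 3
  [:: [::       2; - golden;  0 ];
      [:: - golden;       2; -1 ];
      [::       0;       -1;  2 ] ].

Definition cartan_G24 : 'M[C]_3 := mx_of_seqs 3
  [:: [::  2;       -1;     -1 ];
      [:: -1;        2; alpha7 ];
      [:: -1; alpha7^*;      2 ] ].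

Definition cartan_G25 : 'M[C]_3 := mx_of_seqs 3
  [:: [:: 1 - omega;     omega;         0 ];
      [::        -1; 1 - omega;     omega ];
      [::         0;        -1; 1 - omega ] ].

Definition cartan_G26 : 'M[C]_3 := mx_of_seqs 3
  [:: [::         2;        -1;         0 ];
      [:: omega - 1; 1 - omega;     omega ];
      [::         0;        -1; 1 - omega ] ].

Definition cartan_G30 : 'M[C]_4 := mx_of_seqs 4
  [:: [::       2; - golden;  0;  0 ];
      [:: - golden;       2; -1;  0 ];
      [::       0;       -1;  2; -1 ];
      [::       0;        0; -1;  2 ] ].

Definition cartan_G32 : 'M[C]_4 := mx_of_seqs 4
  [:: [:: 1 - omega;     omega;         0;         0 ];
      [::        -1; 1 - omega;     omega;         0 ];
      [::         0;        -1; 1 - omega;     omega ];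
      [::         0;         0;        -1; 1 - omega ] ].

Definition cartan_G33 : 'M[C]_5 := mx_of_seqs 5
  [:: [::  2;          -1;       0;  0;  0 ];
      [:: -1;           2; - omega; -1;  0 ];
      [::  0; - (omega^*);       2; -1;  0 ];
      [::  0;          -1;      -1;  2; -1 ];
      [::  0;           0;       0; -1;  2 ] ].

Definition cartan_G35 : 'M[C]_6 := mx_of_seqs 6
  [:: [::  2;  0; -1;  0;  0;  0 ];
      [::  0;  2;  0; -1;  0;  0 ];
      [:: -1;  0;  2; -1;  0;  0 ];
      [::  0; -1; -1;  2; -1;  0 ];
      [::  0;  0;  0; -1;  2; -1 ];
      [::  0;  0;  0;  0; -1;  2 ] ].

End CartanMatrices.

Section KZBundle.
Context (R : realType) (gT : finGroupType) (W : {group gT}) (n m : nat).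
Variables (rV : mx_representation R[i] W n) (rU : mx_representation R[i] W m).

Local Notation X := (arrangement_complement rV).

(* Matrix representations act on row vectors from the right; the orbits are
   those of the left action w v = v *m rV w^-1. *)
Definition base_rel : rel X :=
  fun x y => [exists w in W, \val x *m rV w == \val y].

Definition total_rel : rel (X * 'rV[R[i]]_m) :=
  fun p q => [exists w in W,
    (\val p.1 *m rV w == \val q.1) && (p.2 *m rU w == q.2)].

Lemma base_rel_equiv : equiv_class_of base_rel.
Proof.
split=> [x|x y|y x z].
- by apply/existsP; exists 1%g; rewrite group1 repr_mx1 mulmx1 eqxx.
- apply/idP/idP => /existsP[w /andP[Ww /eqP e]]; apply/existsP;
    exists w^-1%g; by rewrite groupV Ww -e repr_mxK// eqxx.
- move=> /existsP[w /andP[Ww /eqP e]] /existsP[w' /andP[Ww' /eqP e']].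
  apply/existsP; exists (w * w')%g.
  by rewrite groupM// repr_mxM// mulmxA e e' eqxx.
Qed.

Lemma total_rel_equiv : equiv_class_of total_rel.
Proof.
split=> [p|p q|q p r].
- by apply/existsP; exists 1%g; rewrite group1 !repr_mx1 !mulmx1 !eqxx.
- apply/idP/idP => /existsP[w /andP[Ww /andP[/eqP e /eqP f]]]; apply/existsP;
    exists w^-1%g; by rewrite groupV Ww -e -f !repr_mxK// !eqxx.
- move=> /existsP[w /andP[Ww /andP[/eqP e /eqP f]]].
  move=> /existsP[w' /andP[Ww' /andP[/eqP e' /eqP f']]].
  apply/existsP; exists (w * w')%g.
  by rewrite groupM// !repr_mxM// !mulmxA e e' f f' !eqxx.
Qed.

Canonical base_equiv := EquivRelPack base_rel_equiv.
Canonical total_equiv := EquivRelPack total_rel_equiv.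

Definition base_space : topologicalType :=
  quotient_topology {eq_quot base_equiv}.

Definition total_space : topologicalType :=
  quotient_topology {eq_quot total_equiv}.

Definition base_class (x : X) : base_space := \pi_{eq_quot base_equiv} x.

Definition total_class (x : X) (u : 'rV[R[i]]_m) : total_space :=
  \pi_{eq_quot total_equiv} (x, u).

Definition bundle_proj (q : total_space) : base_space :=
  base_class (repr (q : {eq_quot total_equiv})).1.

Lemma bundle_projE x u : bundle_proj (total_class x u) = base_class x.
Proof.
rewrite /bundle_proj /total_class; case: piP => -[y v] /eqP.
rewrite eqmodE => /existsP[w /andP[Ww /andP[/eqP e _]]] /=.
apply/esym/eqP; rewrite /base_class eqmodE.
by apply/existsP; exists w; rewrite Ww e eqxx.
Qed.

(* Since W acts freely on X, u |-> [x, u] is a bijection from U onto the fibre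
   over [x]; it transports the vector space structure of U to this fibre,
   independently of the choice of x in its orbit. Linearity on the fibres is
   therefore linearity in u. *)
Definition KZ_bundle_trivial : Prop :=
  exists (Phi : total_space -> base_space * 'rV[R[i]]_m)
         (Psi : base_space * 'rV[R[i]]_m -> total_space),
    [/\ continuous Phi /\ continuous Psi,
        cancel Phi Psi /\ cancel Psi Phi,
        forall q, (Phi q).1 = bundle_proj q
      & forall x, linear (fun u => (Phi (total_class x u)).2)].

End KZBundle.

(* Main.v *)
Require Import Defs.
From mathcomp Require Import all_boot all_order all_algebra all_fingroup.
From mathcomp Require Import mxrepresentation complex.
From mathcomp Require Import all_classical all_reals all_analysis.
From mathcomp Require Import generic_quotient ring zify.

Local Open Scope complex_scope.

(** Let [S] be the algebra of polynomials on [V] and [S^W] that of the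
    invariants. A trivialization of the bundle over [X / W] is the same as a
    continuous map [P] from [X] to the invertible matrices of size [m] such that
    [P (x w) = P x * rU w]; its rows are [m] equivariant maps from [X] to [U]
    that form a basis at every point. Such a frame exists with polynomial
    entries, by Chevalley's theorem that [S] is a free module over [S^W]: the
    module of covariants (equivariant polynomial maps from [V] to [U]) is then
    free of rank [m] over [S^W], and a homogeneous basis [F_1, ..., F_m] of it
    is the frame. The argument below works with the covariants directly.

    Relations. If a relation [sum_i p_i f_i = 0] holds between homogeneous
    invariants [f_i], and [f_0] is not a combination of the others with
    invariant coefficients, then [p_0] lies in the ideal of [S] generated by the
    invariants of positive degree ([hilbert_ideal_syzygy]). This is the step
    that uses reflections: the divided difference [(p \o s - p) / alpha_s] is
    a polynomial of smaller degree. It follows that homogeneous covariants that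
    are independent modulo the products of covariants with invariants of
    positive degree satisfy no relation over [S^W] ([independent_relation]), so
    there are at most [m] of them ([independent_card]).

    Generation. A maximal such family generates all covariants, by the graded
    form of Nakayama's lemma ([covariant_submx]). At a point [x] of trivial
    stabilizer, interpolation on the orbit followed by averaging gives a
    covariant with any prescribed value at [x], so the family spans [U] at [x].
    Hence it has exactly [m] members and its determinant [D] does not vanish at
    the points of trivial stabilizer ([covariant_basis]).

    Purity. The zeros of [D] lie in the fixed spaces of the non-trivial elements
    of [W]. The zeros of a polynomial form a hypersurface, so locally they fill
    some of the fixed spaces that are hyperplanes; away from the reflecting
    hyperplanes [D] has no zero at all ([purity]). For a faithful [U] this
    contains Steinberg's theorem that [W] acts freely on [X].

    The frame being polynomial, the trivialization [[x, u] |-> ([x], u P(x)^-1)]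
    and its inverse are continuous for the quotient topologies
    ([KZ_bundle_trivial_of_frame]). *)

Section EquivariantFrames.

Set Implicit Arguments.
Unset Strict Implicit.
Unset Printing Implicit Defensive.
Import Order.TTheory GRing.Theory Num.Theory GroupScope.
Import numFieldNormedType.Exports.
Local Open Scope classical_set_scope.
Local Open Scope quotient_scope.
Local Open Scope ring_scope.

(** * Homogeneous polynomial functions *)

Section HomogeneousPolynomials.
Context (K : numFieldType) (n : nat).
Implicit Types (f g : 'rV[K]_n -> K) (a : 'cV[K]_n) (v y : 'rV[K]_n).

Definition lform a v : K := (v *m a) 0 0.

Lemma lformD a v y : lform a (v + y) = lform a v + lform a y.
Proof. by rewrite /lform mulmxDl mxE. Qed.

Lemma lformZ a c v : lform a (c *: v) = c * lform a v.
Proof. by rewrite /lform -scalemxAl mxE. Qed.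

Lemma lform_mul p (a : 'cV[K]_p) (A : 'M[K]_(n, p)) v :
  (v *m A *m a) 0 0 = lform (A *m a) v.
Proof. by rewrite /lform mulmxA. Qed.

Lemma lform_neq0 a : a != 0 -> exists v, lform a v != 0.
Proof.
case/cV0Pn=> i ai; exists (delta_mx 0 i).
by rewrite /lform -rowE mxE.
Qed.

Lemma lform_annihilator p (A : 'M[K]_(p, n)) : (\rank A < n)%N ->
  exists2 a, a != 0 & forall v, (v <= A)%MS -> lform a v = 0.
Proof.
move=> rA; have /matrix0Pn[i [j ij]] : cokermx A != 0.
  by rewrite -mxrank_eq0 mxrank_coker subn_eq0 -ltnNge.
exists (col j (cokermx A)); first by apply/cV0Pn; exists i; rewrite mxE.
move=> v; rewrite submxE => /eqP vA.
by rewrite /lform colE mulmxA vA mul0mx mxE.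
Qed.

Lemma lform_separates v : v != 0 -> exists a, lform a v != 0.
Proof.
case/rV0Pn => j vj; exists (delta_mx j 0).
by rewrite /lform -colE mxE.
Qed.

(** Polynomials are taken as functions: the field is infinite, and the action of
    the group, restriction to a line and evaluation all become compositions. The
    last constructor makes the notion extensional. *)
Inductive homog : nat -> ('rV[K]_n -> K) -> Prop :=
| homog_const c : homog 0 (fun=> c)
| homog_lform d a f : homog d f -> homog d.+1 (fun v => lform a v * f v)
| homogD d f g : homog d f -> homog d g -> homog d (fun v => f v + g v)
| homog_ext d f g : homog d f -> f =1 g -> homog d g.

Lemma homog1_lform a : homog 1 (lform a).
Proof.
by apply: homog_ext (homog_lform a (homog_const 1)) _ => v; rewrite mulr1.
Qed.

Lemma homog0 d : homog d (fun=> 0).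
Proof.
elim: d => [|d /(homog_lform 0)]; first exact: homog_const.
by move/homog_ext; apply=> v; rewrite mulr0.
Qed.

Lemma homogZ d c f : homog d f -> homog d (fun v => c * f v).
Proof.
elim=> {d f} [b|d a f _ IH|d f g _ IHf _ IHg|d f g _ IH fg].
- exact: homog_const.
- by apply: homog_ext (homog_lform a IH) _ => v; rewrite mulrCA.
- by apply: homog_ext (homogD IHf IHg) _ => v; rewrite mulrDr.
- by apply: homog_ext IH _ => v; rewrite fg.
Qed.

Lemma homogB d f g : homog d f -> homog d g -> homog d (fun v => f v - g v).
Proof.
move=> hf /(homogZ (-1)) hg; apply: homog_ext (homogD hf hg) _ => v.
by rewrite mulN1r.
Qed.

Lemma homogM d e f g :
  homog d f -> homog e g -> homog (d + e) (fun v => f v * g v).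
Proof.
move=> hf hg; elim: hf => {d f} [b|d a f _ IH|d f1 f2 _ IH1 _ IH2
  |d f1 f2 _ IH f12].
- exact: homogZ.
- by apply: homog_ext (homog_lform a IH) _ => v; rewrite mulrA.
- by apply: homog_ext (homogD IH1 IH2) _ => v; rewrite mulrDl.
- by apply: homog_ext IH _ => v; rewrite f12.
Qed.

Lemma homog_sum (I : Type) (r : seq I) (P : pred I) d (F : I -> 'rV[K]_n -> K) :
  (forall i, P i -> homog d (F i)) ->
  homog d (fun v => \sum_(i <- r | P i) F i v).
Proof.
move=> hF; elim: r => [|i r IH].
  by apply: homog_ext (homog0 d) _ => v; rewrite big_nil.
have [Pi|nPi] := boolP (P i).
  by apply: homog_ext (homogD (hF i Pi) IH) _ => v; rewrite big_cons Pi.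
by apply: homog_ext IH _ => v; rewrite big_cons (negPf nPi).
Qed.

Lemma homog_prod (I : Type) (r : seq I) (d : I -> nat)
    (F : I -> 'rV[K]_n -> K) :
  (forall i, homog (d i) (F i)) ->
  homog (\sum_(i <- r) d i) (fun v => \prod_(i <- r) F i v).
Proof.
move=> hF; elim: r => [|i r IH].
  by rewrite big_nil; apply: homog_ext (homog_const 1) _ => v; rewrite big_nil.
rewrite big_cons; apply: homog_ext (homogM (hF i) IH) _ => v.
by rewrite big_cons.
Qed.

Lemma homog_comp d f (A : 'M[K]_n) :
  homog d f -> homog d (fun v => f (v *m A)).
Proof.
elim=> {d f} [b|d a f _ IH|d f g _ IHf _ IHg|d f g _ IH fg].
- exact: homog_const.
- apply: homog_ext (homog_lform (A *m a) IH) _ => v.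
  by rewrite /lform mulmxA.
- exact: homogD.
- by apply: homog_ext IH _ => v; rewrite fg.
Qed.

(** Reduction to one variable. That the coefficient of degree [d] is the value at
    the direction gives control over the number of roots on a line. *)
Lemma homog_line d f v y : homog d f ->
  exists p : {poly K}, [/\ (size p <= d.+1)%N, p`_d = f y
                         & forall t, p.[t] = f (v + t *: y)].
Proof.
elim=> {d f} [c|d a f _ [p [sp pd pe]]
  |d f g _ [p [sp pd pe]] _ [q [sq qd qe]]|d f g _ [p [sp pd pe]] fg].
- by exists c%:P; split=> [||t]; rewrite ?size_polyC_leq1 ?coefC ?hornerC.
- exists ((lform a v)%:P * p + (lform a y) *: (p * 'X)); split=> [||t].
  + rewrite (leq_trans (size_polyD _ _))// geq_max.
    rewrite mul_polyC !(leq_trans (size_scale_leq _ _))//.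
      by rewrite (leq_trans (size_polyMleq _ _))// size_polyX addn2.
    by rewrite (leq_trans sp).
  + rewrite coefD coefCM coefZ coefMX/= pd nth_default ?mulr0 ?add0r//.
  + by rewrite hornerD hornerCM hornerZ hornerMX pe lformD lformZ; ring.
- exists (p + q); split=> [||t].
  + by rewrite (leq_trans (size_polyD _ _))// geq_max sp.
  + by rewrite coefD pd qd.
  + by rewrite hornerD pe qe.
- by exists p; split=> // [|t]; rewrite -fg.
Qed.

Lemma poly_eq0_horner (p : {poly K}) : (forall t, p.[t] = 0) -> p = 0.
Proof.
move=> p0; apply/eqP/negPn/negP => pn0.
have := max_poly_roots pn0 (rs := [seq i%:R | i <- iota 0 (size p)]).
rewrite size_map size_iota ltnn => /(_ _ _)/notF; apply.
  by apply/allP=> x _; rewrite rootE p0.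
by rewrite map_inj_uniq ?iota_uniq// => i j /eqP; rewrite eqr_nat => /eqP.
Qed.

(** On the line from a point where [f] does not vanish to one where [g] does not
    vanish, both become nonzero univariate polynomials. *)
Lemma homog_neq0_mul d e f g : homog d f -> homog e g ->
    (exists v, f v != 0) -> (exists v, g v != 0) ->
  exists v, f v * g v != 0.
Proof.
move=> hf hg [v fv] [y gy].
have [p [_ _ pE]] := homog_line v (y - v) hf.
have [q [_ _ qE]] := homog_line v (y - v) hg.
apply: contrapT => /forallNP fg0.
have: p * q = 0.
  apply: poly_eq0_horner => t; rewrite hornerM pE qE.
  by apply/eqP/negPn/negP.
move/eqP; rewrite mulf_eq0 => /orP[]/eqP z0.
  by move: fv; rewrite -(addr0 v) -(scale0r (y - v)) -pE z0 horner0 eqxx.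
by move: gy; rewrite -(subrKC v y) -(scale1r (y - v)) -qE z0 horner0 eqxx.
Qed.

Lemma homog_mul_eq0 d e f g : homog d f -> homog e g ->
  (exists v, f v != 0) -> (forall v, f v * g v = 0) -> forall v, g v = 0.
Proof.
move=> hf hg f0 fg0 v; apply: contrapT => /eqP gv.
have [|w] := homog_neq0_mul hf hg f0; first by exists v.
by rewrite fg0 eqxx.
Qed.

Lemma homog_neq0_prod (I : eqType) (r : seq I) (d : I -> nat)
    (F : I -> 'rV[K]_n -> K) :
    (forall i, homog (d i) (F i)) ->
    (forall i, i \in r -> exists v, F i v != 0) ->
  exists v, \prod_(i <- r) F i v != 0.
Proof.
move=> hF; elim: r => [|i r IH] F0.
  by exists 0; rewrite big_nil oner_eq0.
have [||v] := homog_neq0_mul (hF i) (homog_prod r hF).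
- by apply: F0; rewrite mem_head.
- by apply: IH => j jr; apply: F0; rewrite inE jr orbT.
- by exists v; rewrite big_cons.
Qed.

(** The Leibniz rule for [f |-> (f \o s - f) / alpha], where
    [s v = v + alpha(v) b], reduces everything to linear forms. *)
Lemma homog_divided_difference d f a (b : 'rV[K]_n) : homog d f ->
  exists2 q, (if d is e.+1 then homog e q else q =1 fun=> 0)
           & forall v, f (v + lform a v *: b) - f v = lform a v * q v.
Proof.
elim=> {d f} [c|d l f hf [q hq qE]|d f g _ [q hq qE] _ [r hr rE]
  |d f g _ [q hq qE] fg].
- by exists (fun=> 0) => // v; rewrite subrr mulr0.
- exists (fun v => lform l v * q v + lform l b * f (v *m (1%:M + a *m b))).
    apply: homogD; last exact/homogZ/homog_comp.
    case: d hq {hf} => [q0|d hq]; last exact: homog_lform.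
    by apply: homog_ext (homog0 0) _ => v; rewrite q0 mulr0.
  move=> v; have -> : v *m (1%:M + a *m b) = v + lform a v *: b.
    by rewrite mulmxDr mulmx1 mulmxA [v *m a]mx11_scalar mul_scalar_mx.
  rewrite mulrDr [_ * (lform l v * _)]mulrCA -qE lformD lformZ.
  by rewrite mulrBr mulrDl mulrA; ring.
- exists (fun v => q v + r v); last by move=> v; rewrite mulrDr -qE -rE; ring.
  case: d hq hr => [q0 r0 v|d]; last exact: homogD.
  by rewrite q0 r0 addr0.
- by exists q => // v; rewrite -!fg.
Qed.

(** The coefficients of a homogeneous relation between elements of degrees [d_i]
    have degrees [N - d_i], which can be negative. Admitting only [0] in negative
    degrees makes products and divided differences behave uniformly. *)
Definition homog_diff (a b : nat) f : Prop :=
  if (b <= a)%N then homog (a - b) f else f =1 fun=> 0.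

Lemma homog_diff0 (a b : nat) : homog_diff a b (fun=> 0).
Proof. by rewrite /homog_diff; case: ifP => // _; apply: homog0. Qed.

Lemma homog_diffn0 (a : nat) f : homog_diff a 0 f = homog a f.
Proof. by rewrite /homog_diff leq0n subn0. Qed.

Lemma homog_diff_ext (a b : nat) f g :
  homog_diff a b f -> f =1 g -> homog_diff a b g.
Proof.
rewrite /homog_diff; case: ifP => _ hf fg; first exact: homog_ext fg.
by move=> v; rewrite -fg.
Qed.

Lemma homog_diffZ (a b : nat) c f :
  homog_diff a b f -> homog_diff a b (fun v => c * f v).
Proof.
rewrite /homog_diff; case: ifP => _; first exact: homogZ.
by move=> f0 v; rewrite f0 mulr0.
Qed.

Lemma homog_diff_sum (I : Type) (r : seq I) (P : pred I) (a b : nat)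
    (F : I -> 'rV[K]_n -> K) :
  (forall i, P i -> homog_diff a b (F i)) ->
  homog_diff a b (fun v => \sum_(i <- r | P i) F i v).
Proof.
rewrite /homog_diff; case: ifP => _; first exact: homog_sum.
by move=> F0 v; rewrite big1// => i Pi; rewrite F0.
Qed.

Lemma homog_diffM (a b c : nat) f g : homog_diff a b f -> homog_diff b c g ->
  homog_diff a c (fun v => f v * g v).
Proof.
rewrite {1 2}/homog_diff; case: leqP => ba hf; last first.
  by move=> _; apply: homog_diff_ext (homog_diff0 a c) _ => v; rewrite hf mul0r.
case: leqP => cb hg; last first.
  by apply: homog_diff_ext (homog_diff0 a c) _ => v; rewrite hg mulr0.
rewrite /homog_diff (leq_trans cb ba).
have -> : (a - c = (a - b) + (b - c))%N by rewrite addnBA// subnK.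
exact: homogM.
Qed.

Lemma homog_diff_comp (a b : nat) f (A : 'M[K]_n) :
  homog_diff a b f -> homog_diff a b (fun v => f (v *m A)).
Proof.
rewrite /homog_diff; case: ifP => _; first exact: homog_comp.
by move=> f0 v; rewrite f0.
Qed.

Lemma homog_diff_homog (a b : nat) f :
  homog_diff a b f -> exists d, homog d f.
Proof.
rewrite /homog_diff; case: ifP => _ hf; first by exists (a - b)%N.
by exists 0%N; apply: homog_ext (homog0 0) _ => v; rewrite hf.
Qed.

Lemma homog_diff_divided (a b : nat) f (l : 'cV[K]_n) (r : 'rV[K]_n) :
  homog_diff a b f ->
  exists2 q, homog_diff a b.+1 q
           & forall v, f (v + lform l v *: r) - f v = lform l v * q v.
Proof.
rewrite {1}/homog_diff; case: leqP => [ba|ab] hf; last first.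
  exists (fun=> 0); first exact: homog_diff0.
  by move=> v; rewrite !hf subrr mulr0.
have [q hq qE] := homog_divided_difference l r hf; exists q => //.
by rewrite /homog_diff subnS -subn_gt0; case: (a - b)%N hq => [|e].
Qed.

End HomogeneousPolynomials.

(** * Invariants and the Hilbert ideal *)

Section Invariants.
Context (K : numFieldType) (gT : finGroupType) (W : {group gT}) (n : nat).
Variable rV : mx_representation K W n.
Implicit Types (f g p q : 'rV[K]_n -> K) (v : 'rV[K]_n).

(** [rV s - 1] has rank one, so it is a column times a row. *)
Lemma reflection_transvection s : s \in reflections rV ->
  exists (l : 'cV[K]_n) (b : 'rV[K]_n),
    l != 0 /\ forall v, v *m rV s = v + lform l v *: b.
Proof.
rewrite inE => /andP[_ /eqP rk].
have rk1 : \rank (rV s - 1%:M) = 1%N.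
  have := rank_leq_row (rV s - 1%:M).
  by move: rk; rewrite /eigenspace mxrank_ker; case: (\rank _) => [|[|r]]; lia.
have E := mulmx_base (rV s - 1%:M); move: E (col_base_full (rV s - 1%:M)).
move: (col_base _) (row_base _); rewrite rk1 => l b lb lfull.
exists l, b; split.
  by apply: contraTneq lfull => ->; rewrite /row_full mxrank0.
move=> v; rewrite -{1}(subrK 1%:M (rV s)) -lb mulmxDr mulmx1 addrC mulmxA.
by rewrite [v *m l]mx11_scalar mul_scalar_mx.
Qed.

Definition invariant f := forall w v, w \in W -> f (v *m rV w) = f v.

Definition average f v := (#|W|%:R)^-1 * \sum_(w in W) f (v *m rV w).

Lemma cardW_neq0 : #|W|%:R != 0 :> K.
Proof. by rewrite pnatr_eq0 -lt0n cardG_gt0. Qed.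

Lemma average_invariant f : invariant (average f).
Proof.
move=> w v Ww; congr (_ * _).
rewrite [RHS](reindex_inj (mulgI w))/=; apply: eq_big => [x|x Wx].
  by rewrite groupMl.
by rewrite repr_mxM ?mulmxA// -(groupMl _ Ww).
Qed.

Lemma average_id f v : invariant f -> average f v = f v.
Proof.
move=> fI; rewrite /average (eq_bigr (fun=> f v)) => [|w Ww]; last exact: fI.
by rewrite sumr_const -[X in _ * X]mulr_natl mulKf// cardW_neq0.
Qed.

Lemma homog_diff_average a b f :
  homog_diff a b f -> homog_diff a b (average f).
Proof.
move=> hf; apply/homog_diffZ/homog_diff_sum => w _; exact: homog_diff_comp.
Qed.

Lemma average_relation (I : finType) (p f : I -> 'rV[K]_n -> K) :
    (forall i, invariant (f i)) -> (forall v, \sum_i p i v * f i v = 0) ->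
  forall v, \sum_i average (p i) v * f i v = 0.
Proof.
move=> fI rel v.
transitivity ((#|W|%:R)^-1 *
    \sum_(w in W) \sum_i p i (v *m rV w) * f i (v *m rV w)).
  rewrite exchange_big/= mulr_sumr; apply: eq_bigr => i _.
  rewrite -mulrA mulr_suml; congr (_ * _); apply: eq_bigr => w Ww.
  by rewrite fI.
by rewrite big1 ?mulr0.
Qed.

(** The ideal generated by the invariants of positive degree, described by its
    homogeneous elements. *)
Inductive hilbert_ideal : nat -> ('rV[K]_n -> K) -> Prop :=
| hilbert_ideal_gen d e f g : invariant f -> homog d.+1 f -> homog e g ->
    hilbert_ideal (d.+1 + e) (fun v => f v * g v)
| hilbert_ideal0 d : hilbert_ideal d (fun=> 0)
| hilbert_idealD d f g : hilbert_ideal d f -> hilbert_ideal d g ->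
    hilbert_ideal d (fun v => f v + g v)
| hilbert_ideal_ext d f g : hilbert_ideal d f -> f =1 g -> hilbert_ideal d g.

Lemma hilbert_idealM d e f g : homog e g -> hilbert_ideal d f ->
  hilbert_ideal (d + e) (fun v => f v * g v).
Proof.
move=> hg; elim=> {d f} [d e' f h fI hf hh|d|d f1 f2 _ IH1 _ IH2
  |d f f' _ IH ff'].
- rewrite -addnA.
  apply: hilbert_ideal_ext (hilbert_ideal_gen fI hf (homogM hh hg)) _.
  by move=> v; rewrite mulrA.
- by apply: hilbert_ideal_ext (hilbert_ideal0 _) _ => v; rewrite mul0r.
- by apply: hilbert_ideal_ext (hilbert_idealD IH1 IH2) _ => v; rewrite mulrDl.
- by apply: hilbert_ideal_ext IH _ => v; rewrite ff'.
Qed.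

Lemma hilbert_idealZ d c f :
  hilbert_ideal d f -> hilbert_ideal d (fun v => c * f v).
Proof.
move/(hilbert_idealM (homog_const _ c)); rewrite addn0 => /hilbert_ideal_ext.
by apply=> v; rewrite mulrC.
Qed.

Lemma hilbert_ideal_sum (I : Type) (r : seq I) (P : pred I) d
    (F : I -> 'rV[K]_n -> K) :
  (forall i, P i -> hilbert_ideal d (F i)) ->
  hilbert_ideal d (fun v => \sum_(i <- r | P i) F i v).
Proof.
move=> hF; elim: r => [|i r IH].
  by apply: hilbert_ideal_ext (hilbert_ideal0 d) _ => v; rewrite big_nil.
have [Pi|nPi] := boolP (P i).
  apply: hilbert_ideal_ext (hilbert_idealD (hF i Pi) IH) _ => v.
  by rewrite big_cons Pi.
by apply: hilbert_ideal_ext IH _ => v; rewrite big_cons (negPf nPi).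
Qed.

Lemma hilbert_ideal_comp d f w : w \in W ->
  hilbert_ideal d f -> hilbert_ideal d (fun v => f (v *m rV w)).
Proof.
move=> Ww; elim=> {d f} [d e f g fI hf hg|d|d f g _ IHf _ IHg|d f g _ IH fg].
- apply: hilbert_ideal_ext (hilbert_ideal_gen fI hf (homog_comp (rV w) hg)) _.
  by move=> v; rewrite fI.
- exact: hilbert_ideal0.
- exact: hilbert_idealD.
- by apply: hilbert_ideal_ext IH _ => v; rewrite fg.
Qed.

Lemma homog0_const f : homog 0 f -> exists c, forall v, f v = c.
Proof.
move=> hf; exists (f 0) => v.
have [p [/size1_polyC pc _ pE]] := homog_line 0 v hf.
have -> : f v = p.[1] by rewrite pE add0r scale1r.
have -> : f 0 = p.[0] by rewrite pE add0r scale0r.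
by rewrite pc !hornerC.
Qed.

(** The ideal is stable under [W], so the elements of [W] that move [p] only by
    elements of the ideal form a subgroup; it contains the generators. *)
Lemma average_congr d p : <<reflections rV>> = W ->
    homog d p ->
    (forall s, s \in reflections rV ->
       hilbert_ideal d (fun v => p (v *m rV s) - p v)) ->
  hilbert_ideal d (fun v => average p v - p v).
Proof.
move=> genW hp hs.
have hW w : w \in W -> hilbert_ideal d (fun v => p (v *m rV w) - p v).
  pose A := [set x in W |
    `[< hilbert_ideal d (fun v => p (v *m rV x) - p v) >]].
  have gA : group_set A.
    apply/group_setP; split=> [|x y].
      rewrite inE group1; apply/asboolP.
      apply: hilbert_ideal_ext (hilbert_ideal0 d) _.
      by move=> v; rewrite repr_mx1 mulmx1 subrr.
    rewrite !inE => /andP[Wx /asboolP hx] /andP[Wy /asboolP hy].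
    rewrite groupM//; apply/asboolP.
    apply: hilbert_ideal_ext
      (hilbert_idealD (hilbert_ideal_comp Wx hy) hx) _ => v.
    by rewrite repr_mxM// mulmxA subrKA.
  suff /fintype.subsetP sWA : W \subset Group gA.
    by move/sWA; rewrite inE => /andP[_ /asboolP].
  rewrite -genW gen_subG; apply/fintype.subsetP => s sR; rewrite inE.
  by have:= sR; rewrite inE => /andP[-> _]; apply/asboolP/hs.
apply: hilbert_ideal_ext
  (hilbert_idealZ (#|W|%:R)^-1 (hilbert_ideal_sum _ hW)) _.
move=> v /=; rewrite /average big_split/= mulrDr; congr (_ + _).
by rewrite sumr_const -[X in _ * X]mulr_natl mulKf// cardW_neq0.
Qed.

(** Chevalley's lemma. Divided differences along reflections turn a syzygy into
    one whose coefficients have smaller degree, so by induction [p ord0] is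
    congruent modulo the ideal to its transforms under the reflections, hence to
    its average, an invariant of positive degree. In degree zero, [p ord0] is a
    constant, and if it were nonzero averaging the syzygy would express
    [f ord0] through the other invariants. The integer [r] counts the divided
    differences already taken. *)
Lemma hilbert_ideal_syzygy k (d : 'I_k.+1 -> nat) N
    (f : 'I_k.+1 -> 'rV[K]_n -> K) :
    <<reflections rV>> = W ->
    (forall i, invariant (f i)) -> (forall i, homog_diff N (d i) (f i)) ->
    ~ (exists g : 'I_k -> 'rV[K]_n -> K,
         [/\ forall j, invariant (g j),
             forall j, homog_diff (d (lift ord0 j)) (d ord0) (g j)
           & forall v, f ord0 v = \sum_j g j v * f (lift ord0 j) v]) ->
  forall r (p : 'I_k.+1 -> 'rV[K]_n -> K), (r <= d ord0)%N ->
    (forall i, homog_diff (d i) r (p i)) ->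
    (forall v, \sum_i p i v * f i v = 0) ->
  hilbert_ideal (d ord0 - r) (p ord0).
Proof.
move=> genW fI hf nf r p rd hp rel.
move e_def: (d ord0 - r)%N => e.
elim: e r p rd hp rel e_def => [|e IH] r p rd hp rel e_def.
  have rE : r = d ord0 by lia.
  have [|c p0c] := @homog0_const (p ord0).
    by have:= hp ord0; rewrite /homog_diff rd e_def.
  have [c0|c0] := eqVneq c 0.
    by apply: hilbert_ideal_ext (hilbert_ideal0 0) _ => v; rewrite p0c.
  case: nf; exists (fun j v => - c^-1 * average (p (lift ord0 j)) v).
  split=> [j w v Ww|j|v].
  - by rewrite average_invariant.
  - by rewrite -rE; apply/homog_diffZ/homog_diff_average.
  - have := average_relation fI rel v; rewrite big_ord_recl.
    have -> : average (p ord0) v = c.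
      by rewrite average_id// => w v' _; rewrite !p0c.
    move/eqP; rewrite addr_eq0 => /eqP E; apply: (mulfI c0); rewrite E.
    rewrite mulr_sumr -sumrN; apply: eq_bigr => j _.
    move: (average _ _) => a.
    by rewrite !mulrA mulrN divff// mulN1r mulNr.
have hp0 : homog e.+1 (p ord0) by have:= hp ord0; rewrite /homog_diff rd e_def.
suff hs s : s \in reflections rV ->
    hilbert_ideal e.+1 (fun v => p ord0 (v *m rV s) - p ord0 v).
  have avI : hilbert_ideal e.+1 (average (p ord0)).
    have : homog_diff e.+1 0 (average (p ord0)).
      by apply: homog_diff_average; rewrite homog_diffn0.
    rewrite homog_diffn0 => hav.
    have := hilbert_ideal_gen (@average_invariant (p ord0)) hav
      (homog_const _ 1).
    by rewrite addn0 => /hilbert_ideal_ext; apply=> v; rewrite mulr1.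
  have := hilbert_idealD avI (hilbert_idealZ (-1) (average_congr genW hp0 hs)).
  by move/hilbert_ideal_ext; apply=> v; ring.
move=> sR; have [l [b [l0 sE]]] := reflection_transvection sR.
have Ws : s \in W by move: sR; rewrite inE => /andP[].
have /choice[q hq] : forall i, exists q, homog_diff (d i) r.+1 q /\
    forall v, p i (v *m rV s) - p i v = lform l v * q v.
  move=> i; have [q hq qE] := homog_diff_divided l b (hp i).
  by exists q; split=> // v; rewrite sE.
have relq v : \sum_i q i v * f i v = 0.
  have hsum : homog_diff N r.+1 (fun v => \sum_i q i v * f i v).
    apply: homog_diff_sum => i _.
    apply: homog_diff_ext (homog_diffM (hf i) (hq i).1) _ => v'.
    by rewrite mulrC.
  have [D hD] := homog_diff_homog hsum.
  apply: (homog_mul_eq0 (homog1_lform l) hD (lform_neq0 l0)) => v'.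
  rewrite mulr_sumr; under eq_bigr => i _ do rewrite mulrA -(hq i).2 mulrBl.
  rewrite sumrB rel subr0 -[RHS](rel (v' *m rV s)).
  by apply: eq_bigr => i _; rewrite (fI i _ _ Ws).
have := IH r.+1 q _ (fun i => (hq i).1) relq _.
move=> /(_ ltac:(lia) ltac:(lia)) h.
have := hilbert_idealM (homog1_lform l) h.
rewrite addn1 => /hilbert_ideal_ext; apply=> v.
by rewrite (hq ord0).2 mulrC.
Qed.

End Invariants.

(** * Covariants *)

(** Gaussian elimination without fractions: replacing row [i] by
    [p_(i0,0) row_i - p_(i,0) row_i0] clears the first column and raises the
    degrees of all rows by [d i0], so homogeneity is preserved. *)
Lemma homog_relation (K : numFieldType) n m k (d : 'I_k -> nat)
    (p : 'I_k -> 'I_m -> 'rV[K]_n -> K) :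
    (m < k)%N -> (forall i j, homog (d i) (p i j)) ->
  exists N (c : 'I_k -> 'rV[K]_n -> K),
    [/\ forall i, homog_diff N (d i) (c i), exists i v, c i v != 0
      & forall v j, \sum_i c i v * p i j v = 0].
Proof.
elim: m k d p => [|m IH] [|k] d p // mk hp.
  exists (d ord0), (fun i v => if i == ord0 then 1 else 0).
  split=> [i||v []//]; last by exists ord0, 0; rewrite eqxx oner_eq0.
  case: eqP => [->|_]; last exact: homog_diff0.
  by rewrite /homog_diff leqnn subnn; apply: homog_const.
have [[i0 [v0 pn0]]|p0] := pselect (exists i v, p i ord0 v != 0); last first.
  have [||N [c [hc [i [v civ]] rel]]] :=
    IH k (fun i => d (lift ord0 i))
      (fun i j => p (lift ord0 i) (lift ord0 j)) => //.
  exists N, (fun i => if unlift ord0 i is Some j then c j else fun=> 0); split.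
  - by move=> i'; case: unliftP => [j ->|_]; [apply: hc|apply: homog_diff0].
  - by exists (lift ord0 i), v; rewrite liftK.
  - move=> v' j; case: (unliftP ord0 j) => [j' ->|->].
      rewrite big_ord_recl unlift_none mul0r add0r -[RHS](rel v' j').
      by apply: eq_bigr => i' _; rewrite liftK.
    apply: big1 => i' _.
    have /eqP -> : p i' ord0 v' == 0; last by rewrite mulr0.
    by apply/negPn/negP => pn; apply: p0; exists i', v'.
have [||N [c [hc [i [v civ]] rel]]] := IH k (fun i => d (lift i0 i) + d i0)%N
    (fun i j v => p i0 ord0 v * p (lift i0 i) (lift ord0 j) v
                - p (lift i0 i) ord0 v * p i0 (lift ord0 j) v) => //.
  move=> i j; apply: homogB; last exact: homogM.
  by rewrite addnC; apply: homogM.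
have hcp i' e : homog_diff N (d (lift i0 i')) (fun v => c i' v * p i0 e v).
  apply: homog_diffM (hc i') _.
  by rewrite /homog_diff leq_addr addKn.
exists N, (fun i v => if unlift i0 i is Some j then c j v * p i0 ord0 v
                    else - \sum_j c j v * p (lift i0 j) ord0 v); split.
- move=> i'; case: unliftP => [j ->|->]; first exact: hcp.
  apply: (@homog_diff_ext _ _ _ _
    (fun v => -1 * \sum_j c j v * p (lift i0 j) ord0 v)) => [|v']; last first.
    by rewrite mulN1r.
  apply/homog_diffZ/homog_diff_sum => j _; apply: homog_diffM (hc j) _.
  by rewrite /homog_diff leq_addl addnK.
- have [D hD] := homog_diff_homog (hc i).
  have [||v' v'n0] := homog_neq0_mul hD (hp i0 ord0).
    by exists v.
    by exists v0.
  by exists (lift i0 i), v'; rewrite liftK.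
- move=> v' j; rewrite (bigD1_ord i0)//= unlift_none mulNr mulr_suml.
  under [X in _ + X]eq_bigr => i' _ do rewrite liftK.
  rewrite addrC -sumrB; case: (unliftP ord0 j) => [j' ->|->].
    by rewrite -[RHS](rel v' j'); apply: eq_bigr => i' _; ring.
  by apply: big1 => i' _; ring.
Qed.

Section Covariants.
Context (K : numFieldType) (gT : finGroupType) (W : {group gT}) (n m : nat).
Variables (rV : mx_representation K W n) (rU : mx_representation K W m).
Implicit Types (F G : 'rV[K]_n -> 'rV[K]_m) (v : 'rV[K]_n) (u : 'rV[K]_m).

Definition equivariant F :=
  forall w v, w \in W -> F (v *m rV w) = F v *m rU w.

Definition covariant d F :=
  equivariant F /\ forall j, homog d (fun v => F v 0 j).

Definition equivariant_average F v : 'rV[K]_m :=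
  (#|W|%:R)^-1 *: \sum_(w in W) F (v *m rV w) *m rU w^-1%g.

Lemma equivariant_average_equivariant F : equivariant (equivariant_average F).
Proof.
move=> w v Ww; rewrite -scalemxAl; congr (_ *: _).
rewrite [in RHS](reindex_inj (mulgI w))/= mulmx_suml.
apply: eq_big => [x|x Wx]; first by rewrite groupMl.
have -> : rU x^-1%g = rU (w * x)^-1%g *m rU w.
  by rewrite -repr_mxM ?groupV ?groupM// invMg mulgKV.
by rewrite repr_mxM// !mulmxA.
Qed.

Lemma equivariant_average_id F : equivariant F -> equivariant_average F =1 F.
Proof.
move=> FE v; rewrite /equivariant_average (eq_bigr (fun=> F v)) => [|w Ww].
  rewrite sumr_const -[X in _ *: X]scaler_nat scalerA.
  by rewrite mulVf ?scale1r// cardW_neq0.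
by rewrite FE// repr_mxK.
Qed.

Lemma equivariant_averageP d F :
  (forall j, homog d (fun v => F v 0 j)) -> covariant d (equivariant_average F).
Proof.
move=> hF; split; first exact: equivariant_average_equivariant.
move=> j; apply: (@homog_ext _ _ _ (fun v => (#|W|%:R)^-1 *
   \sum_(w in W) \sum_k rU w^-1%g k j * F (v *m rV w) 0 k)) => [|v].
  apply/homogZ/homog_sum => w _; apply: homog_sum => k _.
  exact/homogZ/(homog_comp (rV w) (hF k)).
rewrite !mxE summxE; congr (_ * _); apply: eq_bigr => w _; rewrite mxE.
by apply: eq_bigr => k _; rewrite mulrC.
Qed.

Lemma covariantD d F G :
  covariant d F -> covariant d G -> covariant d (fun v => F v + G v).
Proof.
move=> [FE hF] [GE hG]; split=> [w v Ww|j]; first by rewrite FE// GE// mulmxDl.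
by apply: homog_ext (homogD (hF j) (hG j)) _ => v; rewrite mxE.
Qed.

Lemma invariantZ_covariant d e f F : invariant rV f -> homog_diff d e f ->
  covariant e F -> covariant d (fun v => f v *: F v).
Proof.
move=> fI hf [FE hF]; split=> [w v Ww|j]; first by rewrite fI// FE// scalemxAl.
have := hF j; rewrite -(homog_diffn0 e) => /(homog_diffM hf).
by rewrite homog_diffn0 => /homog_ext; apply=> v; rewrite mxE.
Qed.

(** The part of degree [d] of the product of the module of covariants with the
    ideal of invariants of positive degree. *)
Inductive decomposable : nat -> ('rV[K]_n -> 'rV[K]_m) -> Prop :=
| decomposable_gen d e f F : invariant rV f -> homog d.+1 f -> covariant e F ->
    decomposable (d.+1 + e) (fun v => f v *: F v)
| decomposable0 d : decomposable d (fun=> 0)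
| decomposableD d F G : decomposable d F -> decomposable d G ->
    decomposable d (fun v => F v + G v)
| decomposable_ext d F G : decomposable d F -> F =1 G -> decomposable d G.

Lemma decomposable_sum (I : Type) (r : seq I) (P : pred I) d
    (F : I -> 'rV[K]_n -> 'rV[K]_m) :
  (forall i, P i -> decomposable d (F i)) ->
  decomposable d (fun v => \sum_(i <- r | P i) F i v).
Proof.
move=> hF; elim: r => [|i r IH].
  by apply: decomposable_ext (decomposable0 d) _ => v; rewrite big_nil.
have [Pi|nPi] := boolP (P i).
  apply: decomposable_ext (decomposableD (hF i Pi) IH) _ => v.
  by rewrite big_cons Pi.
by apply: decomposable_ext IH _ => v; rewrite big_cons (negPf nPi).
Qed.

Lemma decomposableZ d c F :
  decomposable d F -> decomposable d (fun v => c *: F v).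
Proof.
elim=> {d F} [d e f F fI hf hF|d|d F G _ IHF _ IHG|d F G _ IH FG].
- apply: decomposable_ext (decomposable_gen
    (_ : invariant rV (fun v => c * f v)) (homogZ c hf) hF) _.
    by move=> w v Ww; rewrite fI.
  by move=> v; rewrite scalerA.
- by apply: decomposable_ext (decomposable0 _) _ => v; rewrite scaler0.
- by apply: decomposable_ext (decomposableD IHF IHG) _ => v; rewrite scalerDr.
- by apply: decomposable_ext IH _ => v; rewrite FG.
Qed.

(** Averaging commutes with the multiplication by an invariant. *)
Lemma hilbert_ideal_average d f u : hilbert_ideal rV d f ->
  decomposable d (equivariant_average (fun v => f v *: u)).
Proof.
elim=> {d f} [d e f g fI hf hg|d|d f g _ IHf _ IHg|d f g _ IH fg].
- have hG : covariant e (equivariant_average (fun v => g v *: u)).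
    apply: equivariant_averageP => j.
    by apply: homog_ext (homogZ (u 0 j) hg) _ => v; rewrite mxE mulrC.
  apply: decomposable_ext (decomposable_gen fI hf hG) _ => v.
  rewrite /equivariant_average scalerA mulrC -scalerA scaler_sumr.
  congr (_ *: _).
  by apply: eq_bigr => w Ww; rewrite fI// scalemxAl scalerA.
- apply: decomposable_ext (decomposable0 _) _ => v.
  rewrite /equivariant_average big1 ?scaler0// => w _.
  by rewrite scale0r mul0mx.
- apply: decomposable_ext (decomposableD IHf IHg) _ => v.
  rewrite /equivariant_average -scalerDr -big_split/=; congr (_ *: _).
  by apply: eq_bigr => w _; rewrite scalerDl mulmxDl.
- apply: decomposable_ext IH _ => v; rewrite /equivariant_average.
  by congr (_ *: _); apply: eq_bigr => w _; rewrite fg.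
Qed.

(** A covariant is its own average, so it suffices to average its coordinates
    one at a time. *)
Lemma covariant_hilbert_ideal d F : equivariant F ->
  (forall j, hilbert_ideal rV d (fun v => F v 0 j)) -> decomposable d F.
Proof.
move=> FE hF.
have := decomposable_sum (index_enum 'I_m) (P := xpredT)
  (fun j _ => hilbert_ideal_average (delta_mx 0 j) (hF j)).
move/decomposable_ext; apply=> v; rewrite -[RHS]equivariant_average_id//.
rewrite /equivariant_average -scaler_sumr exchange_big/=; congr (_ *: _).
apply: eq_bigr => w _; rewrite -mulmx_suml; congr (_ *m _).
by rewrite [RHS]row_sum_delta.
Qed.

(** Linear independence of the classes in the graded quotient of the module of
    covariants by its decomposable elements. *)
Definition independent k (d : 'I_k -> nat) (F : 'I_k -> 'rV[K]_n -> 'rV[K]_m) :=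
  (forall i, covariant (d i) (F i)) /\
  forall N (c : 'I_k -> K),
    decomposable N (fun v => \sum_(i | d i == N) c i *: F i v) ->
  forall i, d i = N -> c i = 0.

(** Induction on the size of the family. If [f ord0] is not a combination of the
    other coefficients, Chevalley's lemma makes [F ord0] decomposable, against
    independence. If it is one, say [sum_j g_j f_j], substituting it leaves a
    relation between the covariants [F_j + g_j F_0]. These are independent again,
    because [g_j F_0] is decomposable, or zero, or a scalar multiple of
    [F_0]. *)
Lemma independent_relation k (d : 'I_k -> nat)
    (F : 'I_k -> 'rV[K]_n -> 'rV[K]_m) N (f : 'I_k -> 'rV[K]_n -> K) :
    <<reflections rV>> = W -> independent d F ->
    (forall i, invariant rV (f i)) -> (forall i, homog_diff N (d i) (f i)) ->
    (forall v, \sum_i f i v *: F i v = 0) ->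
  forall i v, f i v = 0.
Proof.
move=> genW; elim: k d F f => [|k IH] d F f indF fI hf rel; first by case.
have [hF indep] := indF.
case: (pselect (exists g : 'I_k -> 'rV[K]_n -> K,
         [/\ forall j, invariant rV (g j),
             forall j, homog_diff (d (lift ord0 j)) (d ord0) (g j)
           & forall v, f ord0 v = \sum_j g j v * f (lift ord0 j) v])) => [|nf].
  case=> g [gI hg gE].
  pose F' j v := F (lift ord0 j) v + g j v *: F ord0 v.
  have f0 j v : f (lift ord0 j) v = 0.
    apply: (IH (fun j => d (lift ord0 j)) F' (fun j => f (lift ord0 j)))
      => // [|v']; last first.
      rewrite -[RHS](rel v') big_ord_recl addrC gE scaler_suml -big_split/=.
      by apply: eq_bigr => i _; rewrite scalerDr scalerA [_ * g _ _]mulrC.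
    split=> [i|N' c hc].
      exact/(covariantD (hF _))/(invariantZ_covariant (gI i) (hg i)).
    pose G v := \sum_(i | d (lift ord0 i) == N') c i * g i v.
    have GI : invariant rV G.
      by move=> w v' Ww; apply: eq_bigr => i _; rewrite gI.
    have hG : homog_diff N' (d ord0) G.
      by apply: homog_diff_sum => i /eqP <-; apply: homog_diffZ.
    have sumE v' : \sum_(i | d (lift ord0 i) == N') c i *: F' i v' =
        \sum_(i | d (lift ord0 i) == N') c i *: F (lift ord0 i) v' +
        G v' *: F ord0 v'.
      rewrite scaler_suml -big_split/=; apply: eq_bigr => i _.
      by rewrite scalerDr scalerA.
    pose c' e i := if unlift ord0 i is Some j then c j else e : K.
    have sumc' e v' : \sum_(i | d i == N') c' e i *: F i v' =
        (if d ord0 == N' then e *: F ord0 v' else 0) +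
        \sum_(i | d (lift ord0 i) == N') c i *: F (lift ord0 i) v'.
      rewrite big_mkcond big_ord_recl/= {1}/c' unlift_none; congr (_ + _).
      by rewrite -big_mkcond/=; apply: eq_bigr => i _; rewrite /c' liftK.
    move=> i di; suff [e he] : exists e, decomposable N'
        (fun v => \sum_(i | d i == N') c' e i *: F i v).
      by rewrite -(indep N' _ he (lift ord0 i) di) /c' liftK.
    case: (ltngtP (d ord0) N') => dN.
    - exists 0; have : decomposable N' (fun v => -1 *: (G v *: F ord0 v)).
        apply: decomposableZ.
        have hG' : homog (N' - d ord0).-1.+1 G.
          by move: hG; rewrite /homog_diff ltnW// prednK// subn_gt0.
        have := decomposable_gen GI hG' (hF ord0).
        by rewrite prednK ?subn_gt0// subnK// ltnW.
      move/(decomposableD hc)/decomposable_ext; apply=> v'.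
      by rewrite sumE sumc' lt_eqF// scaleN1r addrK add0r.
    - exists 0; apply: decomposable_ext hc _ => v'; rewrite sumE sumc' gt_eqF//.
      move: hG; rewrite /homog_diff leqNgt dN/= => ->.
      by rewrite scale0r addr0 add0r.
    - have [|e Ge] := @homog0_const _ _ G.
        by move: hG; rewrite /homog_diff dN leqnn subnn.
      exists e; apply: decomposable_ext hc _ => v'.
      by rewrite sumE sumc' dN eqxx Ge addrC.
  move=> i v; case: (unliftP ord0 i) => [j ->|->]; first exact: f0.
  by rewrite gE big1// => j _; rewrite f0 mulr0.
have dec0 : decomposable (d ord0) (F ord0).
  apply: covariant_hilbert_ideal => [|j]; first exact: (hF ord0).1.
  rewrite -(subn0 (d ord0)).
  apply: (hilbert_ideal_syzygy genW fI hf nf (r := 0%N)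
    (p := fun i v => F i v 0 j)) => //.
    by move=> i; rewrite homog_diffn0; apply: (hF i).2.
  move=> v; have /rowP/(_ j) := rel v; rewrite summxE !mxE => E.
  by rewrite -[RHS]E; apply: eq_bigr => i _; rewrite mxE mulrC.
suff: (ord0 == ord0 :> 'I_k.+1)%:R = 0 :> K.
  by move/eqP; rewrite eqxx oner_eq0.
apply: (indep (d ord0) (fun i => (i == ord0)%:R) _ ord0 erefl).
apply: decomposable_ext dec0 _ => v.
rewrite (bigD1 ord0)//= scale1r big1 ?addr0// => i /andP[_ /negPf ->].
by rewrite scale0r.
Qed.

Lemma average_covariant_relation (I : finType) (p : I -> 'rV[K]_n -> K)
    (F : I -> 'rV[K]_n -> 'rV[K]_m) :
    (forall i, equivariant (F i)) -> (forall v, \sum_i p i v *: F i v = 0) ->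
  forall v, \sum_i average rV (p i) v *: F i v = 0.
Proof.
move=> FE rel v; transitivity ((#|W|%:R)^-1 *: \sum_(w in W)
    (\sum_i p i (v *m rV w) *: F i (v *m rV w)) *m rU w^-1%g).
  under [in RHS]eq_bigr => w _ do rewrite mulmx_suml.
  rewrite exchange_big/= scaler_sumr; apply: eq_bigr => i _.
  rewrite -scalerA scaler_suml; congr (_ *: _); apply: eq_bigr => w Ww.
  by rewrite FE// -scalemxAl repr_mxK.
by rewrite big1 ?scaler0// => w _; rewrite rel mul0mx.
Qed.

(** More than [m] vectors of length [m] satisfy a relation with polynomial
    coefficients. Multiplying it by the other conjugates of a nonzero coefficient
    turns this coefficient into a norm, which survives averaging; the averaged
    relation has invariant coefficients. *)
Lemma independent_card k (d : 'I_k -> nat) (F : 'I_k -> 'rV[K]_n -> 'rV[K]_m) :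
  <<reflections rV>> = W -> independent d F -> (k <= m)%N.
Proof.
move=> genW indF; rewrite leqNgt; apply/negP => mk.
have [N [c [hc [i0 [v0 cn0]] rel]]] :=
  homog_relation (p := fun i j v => F i v 0 j) mk (fun i => (indF.1 i).2).
have [D hD] := homog_diff_homog (hc i0).
pose P v := \prod_(w in W :\ 1%g) c i0 (v *m rV w).
have [e he] : exists e, homog e P.
  exists (\sum_(w <- enum (W :\ 1%g)) D)%N.
  have := homog_prod (enum (W :\ 1%g)) (fun w : gT => homog_comp (rV w) hD).
  by move/homog_ext; apply=> v; rewrite big_enum.
have PcE v : P v * c i0 v = \prod_(w in W) c i0 (v *m rV w).
  by rewrite (big_setD1 1%g)//= repr_mx1 mulmx1 mulrC.
have PcI : invariant rV (fun v => P v * c i0 v).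
  move=> w v Ww; rewrite !PcE [RHS](reindex_inj (mulgI w))/=.
  apply: eq_big => [x|x Wx]; first by rewrite groupMl.
  by rewrite repr_mxM// mulmxA.
have [v Pcn0] : exists v, P v * c i0 v != 0.
  have [w|v] := homog_neq0_prod (r := enum W)
    (fun w : gT => homog_comp (rV w) hD).
  - rewrite mem_enum => Ww; exists (v0 *m rV w^-1%g).
    by rewrite repr_mxKV.
  - by rewrite big_enum; exists v; rewrite PcE.

have hPc i : homog_diff (e + N) (d i) (fun v => P v * c i v).
  by apply: homog_diffM (hc i); rewrite /homog_diff leq_addl addnK.
have := independent_relation genW indF
  (fun i => @average_invariant _ _ _ _ rV (fun v => P v * c i v))
  (fun i => homog_diff_average rV (hPc i)).
move=> /(_ _ i0 v) H; move: Pcn0; rewrite -(average_id v PcI) H ?eqxx// => v'.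
apply: average_covariant_relation => [i|v''].
  exact: (indF.1 i).1.
under eq_bigr => i _ do rewrite -scalerA.
rewrite -scaler_sumr; apply/rowP => j; rewrite !mxE summxE.
by under eq_bigr => i _ do rewrite mxE; rewrite rel mulr0.
Qed.

Lemma exists_maximal_independent : <<reflections rV>> = W ->
  exists k (d : 'I_k -> nat) (F : 'I_k -> 'rV[K]_n -> 'rV[K]_m),
    independent d F /\
    forall (d' : 'I_k.+1 -> nat) (F' : 'I_k.+1 -> 'rV[K]_n -> 'rV[K]_m),
      ~ independent d' F'.
Proof.
move=> genW.
pose Q k := `[< exists (d : 'I_k -> nat)
    (F : 'I_k -> 'rV[K]_n -> 'rV[K]_m), independent d F >].
have Q0 : exists k, Q k.
  exists 0%N; apply/asboolP; exists (fun=> 0%N), (fun _ _ => 0).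
  by split=> [[]//|N c _ []].
have Qle k : Q k -> (k <= m)%N.
  by case/asboolP => d [F]; apply: independent_card.
case: (ex_maxnP Q0 Qle) => k /asboolP[d [F indF]] kmax.
exists k, d, F; split=> // d' F' ind'.
have /kmax : Q k.+1 by apply/asboolP; exists d', F'.
by rewrite ltnn.
Qed.

(** The family enlarged by [G] is dependent, and the dependence has to involve
    [G]. *)
Lemma maximal_independent_generates k (d : 'I_k -> nat)
    (F : 'I_k -> 'rV[K]_n -> 'rV[K]_m) :
    independent d F ->
    (forall (d' : 'I_k.+1 -> nat) (F' : 'I_k.+1 -> 'rV[K]_n -> 'rV[K]_m),
       ~ independent d' F') ->
  forall e G, covariant e G -> exists c : 'I_k -> K,
    decomposable e (fun v => G v - \sum_(i | d i == e) c i *: F i v).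
Proof.
move=> [hF indep] Fmax e G hG.
pose d' i := if unlift ord0 i is Some j then d j else e.
pose F' i := if unlift ord0 i is Some j then F j else G.
have d'0 : d' ord0 = e by rewrite /d' unlift_none.
have d'S j : d' (lift ord0 j) = d j by rewrite /d' liftK.
have F'0 : F' ord0 = G by rewrite /F' unlift_none.
have F'S j : F' (lift ord0 j) = F j by rewrite /F' liftK.
have sumE N (c : 'I_k.+1 -> K) v : \sum_(i | d' i == N) c i *: F' i v =
    (if e == N then c ord0 *: G v else 0) +
    \sum_(i | d i == N) c (lift ord0 i) *: F i v.
  rewrite big_mkcond big_ord_recl/= d'0 F'0; congr (_ + _).
  by rewrite -big_mkcond/=; apply: eq_big => i => [|_]; rewrite ?d'S ?F'S.
have /not_andP[] := Fmax d' F'.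
  by case=> i; case: (unliftP ord0 i) => [j ->|->]; rewrite ?d'S ?F'S ?d'0 ?F'0.
move/existsNP => [N /existsNP[c /not_implyP[hc]]].
move=> /existsNP[i /not_implyP[di /eqP ci]].
have [/andP[/eqP eN c0]|/nandP nec] := boolP ((e == N) && (c ord0 != 0)).
  exists (fun i => - (c ord0)^-1 * c (lift ord0 i)).
  rewrite eN; apply: decomposable_ext (decomposableZ (c ord0)^-1 hc) _ => v.
  rewrite sumE eN eqxx scalerDr scalerA mulVf// scale1r; congr (_ + _).
  rewrite scaler_sumr -sumrN; apply: eq_bigr => j _.
  by rewrite mulNr scaleNr opprK scalerA.
have cS j : d j = N -> c (lift ord0 j) = 0.
  apply: (indep N (fun j => c (lift ord0 j))).
  apply: decomposable_ext hc _ => v; rewrite sumE.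
  case: ifP => [eN|_]; last by rewrite add0r.
  by move: nec; rewrite eN negbK => -[//|/eqP ->]; rewrite scale0r add0r.
exfalso; move: di ci; case: (unliftP ord0 i) => [j ->|->].
  by rewrite d'S => /cS ->; rewrite eqxx.
by rewrite d'0 => eN c0; case: nec; rewrite ?eN ?eqxx ?c0.
Qed.

(** Graded Nakayama: what generates modulo decomposables generates. *)
Lemma covariant_submx k (d : 'I_k -> nat) (F : 'I_k -> 'rV[K]_n -> 'rV[K]_m) :
    (forall e G, covariant e G -> exists c : 'I_k -> K,
       decomposable e (fun v => G v - \sum_(i | d i == e) c i *: F i v)) ->
  forall e G x, covariant e G -> (G x <= \matrix_i F i x)%MS.
Proof.
move=> gen e G x; elim/ltn_ind: e G => e IH G /gen[c].
set A := \matrix_i F i x.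
have decA d' G' : decomposable d' G' -> (d' <= e)%N -> (G' x <= A)%MS.
  elim=> {d' G'} [d' e' f G' fI hf hG|d'|d' G1 G2 _ IH1 _ IH2
    |d' G1 G2 _ IH' G12] de.
  - by apply/scalemx_sub/(IH e') => //; lia.
  - exact: sub0mx.
  - by rewrite addmx_sub ?IH1 ?IH2.
  - by rewrite -G12 IH'.
move/decA => /(_ (leqnn e)) H.
rewrite -(subrK (\sum_(i | d i == e) c i *: F i x) (G x)).
rewrite addmx_sub// summx_sub// => i _; apply: scalemx_sub.
by rewrite -(rowK (fun i => F i x) i) row_sub.
Qed.

Definition free_point (x : 'rV[K]_n) :=
  forall w, w \in W -> x *m rV w = x -> w = 1%g.

(** Two points of an orbit can be proportional, so that homogeneous polynomials do
    not separate them; interpolation requires sums of different degrees. *)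
Inductive polynomial : ('rV[K]_n -> K) -> Prop :=
| polynomial_homog d f : homog d f -> polynomial f
| polynomialD f g : polynomial f -> polynomial g ->
    polynomial (fun v => f v + g v)
| polynomial_ext f g : polynomial f -> f =1 g -> polynomial g.

Lemma polynomial_affine (l : 'cV[K]_n) c f :
  polynomial f -> polynomial (fun v => (lform l v - c) * f v).
Proof.
elim=> {f} [d f hf|f g _ IHf _ IHg|f g _ IH fg].
- have h1 := polynomial_homog (homog_lform l hf).
  have h2 := polynomial_homog (homogZ (- c) hf).
  by apply: polynomial_ext (polynomialD h1 h2) _ => v; rewrite mulrDl.
- by apply: polynomial_ext (polynomialD IHf IHg) _ => v; rewrite mulrDr.
- by apply: polynomial_ext IH _ => v; rewrite fg.
Qed.

Lemma polynomial_average_submx k (A : 'M[K]_(k, m)) x u f :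
    (forall e G, covariant e G -> (G x <= A)%MS) ->
  polynomial f -> (equivariant_average (fun v => f v *: u) x <= A)%MS.
Proof.
move=> hA; elim=> {f} [d f hf|f g _ IHf _ IHg|f g _ IH fg].
- apply: (hA d); apply: equivariant_averageP => j.
  by apply: homog_ext (homogZ (u 0 j) hf) _ => v; rewrite mxE mulrC.
- suff -> : equivariant_average (fun v => (f v + g v) *: u) x =
    equivariant_average (fun v => f v *: u) x +
    equivariant_average (fun v => g v *: u) x.
    by rewrite addmx_sub.
  rewrite /equivariant_average -scalerDr -big_split/=; congr (_ *: _).
  by apply: eq_bigr => w _; rewrite scalerDl mulmxDl.
- suff <- : equivariant_average (fun v => f v *: u) x =
    equivariant_average (fun v => g v *: u) x by [].
  by congr (_ *: _); apply: eq_bigr => w _; rewrite fg.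
Qed.

(** The product of one affine function for each [w], which vanishes at [x w] and
    not at [x]. *)
Lemma free_interpolation x : free_point x ->
  exists2 f, polynomial f & f x != 0 /\
    forall w, w \in W -> w != 1%g -> f (x *m rV w) = 0.
Proof.
move=> xfree.
suff [f hf [fx f0]] : exists2 f, polynomial f & f x != 0 /\
    forall w, w \in enum (W :\ 1%g) -> f (x *m rV w) = 0.
  by exists f => //; split=> // w Ww w1; rewrite f0// mem_enum !inE w1.
have : {subset enum (W :\ 1%g) <= W :\ 1%g} by move=> w; rewrite mem_enum.
elim: (enum _) => [|w r IH] sr.
  exists (fun=> 1); last by rewrite oner_eq0.
  exact: polynomial_homog (homog_const _ 1).
have [w' w'r|f hf [fx f0]] := IH; first by apply: sr; rewrite inE w'r orbT.
have /finset.setD1P[w1 Ww] := sr w (mem_head _ _).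
have [|l] := @lform_separates _ _ (x - x *m rV w).
  by rewrite subr_eq0 eq_sym; apply: contra w1 => /eqP/xfree->.
rewrite -scaleN1r lformD lformZ mulN1r => lx.
exists (fun v => (lform l v - lform l (x *m rV w)) * f v).
  exact: polynomial_affine.
split=> [|w']; first by rewrite mulf_neq0.
rewrite inE => /predU1P[->|w'r]; first by rewrite subrr mul0r.
by rewrite f0// mulr0.
Qed.

(** Only the identity contributes to the value at [x] of the average of [f u],
    when [f] vanishes on the rest of the orbit of [x]. *)
Lemma free_covariants_full k (A : 'M[K]_(k, m)) x : free_point x ->
  (forall e G, covariant e G -> (G x <= A)%MS) -> row_full A.
Proof.
move=> /free_interpolation[f hf [fx f0]] hA; apply/row_fullP.
suff /row_subP/submxP[B ->] : forall i : 'I_m, (row i 1%:M <= A)%MS by exists B.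
move=> i; have := polynomial_average_submx (row i 1%:M) hA hf.
rewrite /equivariant_average (bigD1 1%g)//= big1 ?addr0.
  rewrite invg1 !repr_mx1 !mulmx1 scalerA.
  move=> /(scalemx_sub (#|W|%:R^-1 * f x)^-1).
  by rewrite scalerA mulVf ?scale1r// mulf_neq0// invr_eq0 cardW_neq0.
by move=> w /andP[Ww w1]; rewrite f0// scale0r mul0mx.
Qed.

(** The members of a maximal independent family span at one free point, which
    forces their number to be exactly [m]. *)
Lemma covariant_basis : <<reflections rV>> = W -> (exists x, free_point x) ->
  exists (d : 'I_m -> nat) (F : 'I_m -> 'rV[K]_n -> 'rV[K]_m),
    (forall i, covariant (d i) (F i)) /\
    forall x, free_point x -> \matrix_i F i x \in unitmx.
Proof.
move=> genW [x0 x0free].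
have [k [d [F [indF Fmax]]]] := exists_maximal_independent genW.
have gen := covariant_submx (maximal_independent_generates indF Fmax).
have full x : free_point x -> row_full (\matrix_i F i x).
  by move=> xfree; apply: (free_covariants_full xfree) => e G; apply: gen.
have km : k = m.
  apply/eqP; rewrite eqn_leq (independent_card genW indF)/=.
  have /eqP <- := full x0 x0free; exact: rank_leq_row.
subst k; exists d, F; split=> [|x xfree]; first exact: indF.1.
by rewrite -row_full_unit full.
Qed.

End Covariants.

(** * Free points and purity *)

Section FreePoints.
Context (K : numFieldType) (gT : finGroupType) (W : {group gT}) (n : nat).
Variable rV : mx_representation K W n.
Hypothesis faithV : mx_faithful rV.

Lemma rank_fixed w : w \in W -> w != 1%g -> (\rank (eigenspace (rV w) 1) < n)%N.
Proof.
move=> Ww w1; rewrite ltn_neqAle rank_leq_row andbT; apply: contra w1 => full.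
apply/eqP/(mx_faithful_inj faithV Ww (group1 W)); rewrite repr_mx1.
have /eigenspaceP : (1%:M <= eigenspace (rV w) 1)%MS by apply: submx_full.
by rewrite mul1mx scale1r.
Qed.

(** A vector space over an infinite field is not a finite union of proper
    subspaces. *)
Lemma exists_free_point : exists x, free_point rV x.
Proof.
have /choice[l lP] : forall w : gT, exists l, w \in W :\ 1%g -> l != 0 /\
    forall x, x *m rV w = x -> lform l x = 0.
  move=> w; have [/finset.setD1P[w1 Ww]|_] := boolP (w \in W :\ 1%g);
    last by exists 0.
  have [l l0 lP] := lform_annihilator (rank_fixed Ww w1).
  by exists l => _; split=> // x xw; apply/lP/eigenspaceP; rewrite scale1r.
have [w|x] := homog_neq0_prod (r := enum (W :\ 1%g))
  (fun w => homog1_lform (l w)).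
  by rewrite mem_enum => /lP[/lform_neq0].
rewrite big_enum => /prodf_neq0 x0; exists x => w Ww xw.
apply: contrapT => /eqP w1.
have Ww1 : w \in W :\ 1%g by rewrite !inE w1.
by have := x0 w Ww1; rewrite (lP w Ww1).2 ?eqxx.
Qed.

End FreePoints.

(** The zero locus of a polynomial is a hypersurface, so it has no point around
    which it lies in finitely many subspaces of codimension at least two. Here
    the zeros of [D] lie in the fixed spaces of the non-trivial elements, and
    those through [x] have codimension at least two. Perturbing [x] to [x + c z]
    and looking for zeros in the direction [y], all the roots in [t] of
    [D (x + c z + t y)] come from fixed spaces that avoid [x], so their product
    [D (x + c z) / D y] does not tend to [0] with [c]. *)
Lemma purity (K : numClosedFieldType) (gT : finGroupType) (W : {group gT})
    (n : nat) (rV : mx_representation K W n) d (D : 'rV[K]_n -> K) x :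
    mx_faithful rV -> homog d D -> (forall y, free_point rV y -> D y != 0) ->
    (forall s, s \in reflections rV -> x *m rV s != x) ->
  D x != 0.
Proof.
move=> faithV hD Dfree xreg.
(* the elements whose fixed space avoids [x], cut out by forms [l w] *)
pose B := [set w in W | x *m rV w != x].
have /choice[l lP] : forall w, exists l, w \in B ->
    lform l x != 0 /\ forall v, v *m rV w = v -> lform l v = 0.
  move=> w; have [|_] := boolP (w \in B); last by exists 0.
  rewrite inE -subr_eq0 => /andP[Ww /lform_separates[l lx]].
  exists ((rV w - 1%:M) *m l) => _.
  rewrite -lform_mul mulmxBr mulmx1; split=> // v vw.
  by rewrite -lform_mul mulmxBr mulmx1 vw subrr mul0mx mxE.
have [y] : exists y, D y * \prod_(w <- enum B) lform (l w) y != 0.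
  apply: (homog_neq0_mul hD
    (homog_prod (enum B) (fun w => homog1_lform (l w)))).
    by have [v /Dfree] := exists_free_point faithV; exists v.
  apply: (homog_neq0_prod (fun w => homog1_lform (l w))) => w.
  by rewrite mem_enum => /lP[lx _]; exists x.
rewrite mulf_eq0 negb_or big_enum => /andP[Dy /prodf_neq0 ly].
(* [mu w] exists because the span of [y] and the fixed space of [w] is proper,
   that space having codimension at least two *)
have /choice[mu muP] : forall w, exists mu : 'cV[K]_n,
    w \in (W :\ 1%g) :\: B -> [/\ mu != 0, lform mu y = 0
      & forall v, v *m rV w = v -> lform mu v = 0].
  move=> w; have [|_] := boolP (w \in (W :\ 1%g) :\: B); last by exists 0.
  rewrite !inE => /and3P[wB w1 Ww].
  have [|mu mu0 muP] :=
    @lform_annihilator _ _ _ (eigenspace (rV w) 1 + <<y>>)%MS.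
    have rk := rank_fixed faithV Ww w1.
    apply: leq_ltn_trans (mxrank_adds_leqif _ _) _.
    rewrite genmxE (leq_ltn_trans (leq_add (leqnn _) (rank_leq_row y)))// addn1.
    rewrite ltn_neqAle rk andbT; apply/negP => rkn.
    have /xreg : w \in reflections rV by rewrite inE Ww.
    by rewrite Ww/= negbK in wB; rewrite wB.
  exists mu => _; split=> // [|v vw]; apply: muP.
    by rewrite (submx_trans _ (addsmxSr _ _))// genmxE.
  rewrite (submx_trans _ (addsmxSl _ _))//.
  by apply/eigenspaceP; rewrite scale1r.
have [w|z] := homog_neq0_prod (r := enum ((W :\ 1%g) :\: B))
    (fun w => homog1_lform (mu w)).
  by rewrite mem_enum => /muP[/lform_neq0].
rewrite big_enum => /prodf_neq0 muz.
(* the opposite of the root in [t] due to [w], as a function of [c] *)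
pose e w := (lform (l w) x / lform (l w) y)%:P
          + (lform (l w) z / lform (l w) y) *: 'X.
have [P [_ _ PE]] := homog_line x z hD.
pose E (s : {ffun 'I_d -> gT}) := (D y)%:P * \prod_i e (s i).
have key c : c != 0 -> exists2 s, s \in ffun_on (mem B) & P.[c] = (E s).[c].
  move=> c0; have [p [sp pd pE]] := homog_line (x + c *: z) y hD.
  have szp : size p = d.+1.
    apply/eqP; rewrite eqn_leq sp ltnNge.
    apply/negP => /leq_sizeP/(_ d (leqnn d)).
    by move/eqP; rewrite pd (negPf Dy).
  have lcp : lead_coef p = D y by rewrite lead_coefE szp.
  have [r pr] := closed_field_poly_normal p.
  have szr : size r = d.
    by have := szp; rewrite pr lcp size_scale// size_prod_XsubC => -[].
  have /choice[s sP] : forall i : 'I_d, exists w,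
      w \in B /\ - r`_i = (e w).[c].
    move=> i; set t := r`_i.
    have D0 : D (x + c *: z + t *: y) = 0.
      rewrite -pE pr; apply/rootP; rewrite rootZ ?lcp//.
      by rewrite root_prod_XsubC mem_nth// szr.
    have [w [Ww w1 wq]] : exists w, [/\ w \in W, w != 1%g
        & (x + c *: z + t *: y) *m rV w = x + c *: z + t *: y].
      apply: contrapT => /forallNP nw.
      suff /Dfree : free_point rV (x + c *: z + t *: y) by rewrite D0 eqxx.
      by move=> w Ww wq; apply: contrapT => /eqP w1; apply: (nw w).
    have wB : w \in B.
      apply/negPn/negP => wB; have xw : x *m rV w = x.
        by apply/eqP; move: wB; rewrite inE Ww negbK.
      have wS : w \in (W :\ 1%g) :\: B.
        by rewrite !finset.in_setD wB finset.in_set1 w1.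
      have [_ muy muE] := muP w wS.
      have : lform (mu w) (c *: z + t *: y) = 0.
        by apply/muE/(addrI x); rewrite -{1}xw -mulmxDl addrA.
      move/eqP; rewrite lformD !lformZ muy mulr0 addr0 mulf_eq0.
      by rewrite (negPf c0) (negPf (muz w wS)).
    exists w; split=> //; have := (lP w wB).2 _ wq.
    rewrite !lformD !lformZ => /eqP; rewrite addr_eq0 => /eqP lw.
    rewrite hornerD hornerC hornerZ hornerX mulrAC -mulrDl [_ * c]mulrC lw.
    by rewrite mulNr mulfK// ly.
  exists [ffun i => s i].
    by apply/ffun_onP => i; rewrite ffunE; case: (sP i).
  rewrite PE -[x + _](addr0) -(scale0r y) -pE pr lcp hornerZ hornerM hornerC.
  congr (_ * _); rewrite !horner_prod (big_nth 0) big_mkord szr.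
  by apply: eq_bigr => i _; rewrite hornerXsubC sub0r ffunE (sP i).2.
(* Which [s] occurs depends on [c], but there are finitely many; the factor ['X]
   takes care of [c = 0]. *)
have Q0 : 'X * \prod_(s in ffun_on (mem B)) (P - E s) = 0.
  apply: poly_eq0_horner => c; rewrite hornerM hornerX.
  have [->|c0] := eqVneq c 0; first by rewrite mul0r.
  have [s sB Ps] := key c c0.
  by rewrite horner_prod (bigD1 s)//= hornerD hornerN Ps subrr mul0r mulr0.
move/eqP: Q0; rewrite mulf_eq0 polyX_eq0 => /prodf_eq0[s sB].
rewrite subr_eq0 => /eqP PEs.
rewrite -[x]addr0 -(scale0r z) -PE PEs /E hornerM hornerC horner_prod.
rewrite mulf_neq0//; apply/prodf_neq0 => i _.
have /lP[lx _] : s i \in B by move/ffun_onP: sB; apply.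
rewrite /e hornerD hornerC hornerZ hornerX mulr0 addr0 mulf_neq0// invr_eq0 ly//.
by move/ffun_onP: sB; apply.
Qed.

(** * The equivariant frame *)

Lemma homog_det (K : numFieldType) n m (d : 'I_m -> nat)
    (P : 'rV[K]_n -> 'M[K]_m) :
    (forall i j, homog (d i) (fun v => P v i j)) ->
  homog (\sum_(i < m) d i) (fun v => \det (P v)).
Proof.
move=> hP; apply: homog_sum => s _; apply/homogZ.
by apply: homog_prod => i; apply: hP.
Qed.

(** The determinant of the basis of covariants is homogeneous and does not vanish
    at free points, so purity applies to it. *)
Lemma equivariant_frame (K : numClosedFieldType) (gT : finGroupType)
    (W : {group gT}) (n m : nat) (rV : mx_representation K W n)
    (rU : mx_representation K W m) :
    mx_faithful rV -> <<reflections rV>> = W ->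
  exists P : 'rV[K]_n -> 'M[K]_m,
    [/\ forall i j, exists d, homog d (fun v => P v i j),
        forall w v, w \in W -> P (v *m rV w) = P v *m rU w
      & forall x, (forall s, s \in reflections rV -> x *m rV s != x) ->
          P x \in unitmx].
Proof.
move=> faithV genW.
have [d [F [hF Funit]]] :=
  covariant_basis rU genW (exists_free_point faithV).
exists (fun v => \matrix_i F i v); split=> [i j|w v Ww|x xreg].
- by exists (d i); apply: homog_ext ((hF i).2 j) _ => v; rewrite mxE.
- by apply/row_matrixP => i; rewrite row_mul !rowK (hF i).1.
- rewrite unitmxE unitfE.
  apply: (purity (D := fun v => \det (\matrix_i F i v)) faithV _ _ xreg).
    apply: homog_det => i j.
    by apply: homog_ext ((hF i).2 j) _ => v; rewrite mxE.
  by move=> y /Funit; rewrite unitmxE unitfE.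
Qed.

(** * Continuity *)

Section ContinuousMatrices.
Context (R : realType) (T : topologicalType).

Lemma continuous_mulC (f g : T -> R[i]) :
  continuous f -> continuous g -> continuous (fun x => f x * g x).
Proof. by move=> cf cg x; apply: (@cvgM R[i]); [exact: cf|exact: cg]. Qed.

Lemma continuous_addC (f g : T -> R[i]) :
  continuous f -> continuous g -> continuous (fun x => f x + g x).
Proof. by move=> cf cg x; apply: (@cvgD R[i] R[i]); [exact: cf|exact: cg]. Qed.

Lemma continuous_mx p q (f : T -> 'M[R[i]]_(p, q)) :
  (forall i j, continuous (fun x => f x i j)) -> continuous f.
Proof.
move=> cf x A [P fP PA].
have nP i : \forall y \near x, forall j, P i j (f y i j).
  by apply: (filter_forall (nbhs_filter x)) => j; apply: (cf i j x _ (fP i j)).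
have := filter_forall (nbhs_filter x) nP.
by apply: filterS => y; apply: PA.
Qed.

Lemma continuous_entry p q (f : T -> 'M[R[i]]_(p, q)) i j :
  continuous f -> continuous (fun x => f x i j).
Proof.
move=> cf x.
apply: (@continuous_comp _ _ _ f (fun M : 'M[R[i]]_(p, q) => M i j)).
  exact: cf.
exact: coord_continuous.
Qed.

Lemma continuous_sumC I (r : seq I) (F : I -> T -> R[i]) :
  (forall i, continuous (F i)) -> continuous (fun x => \sum_(i <- r) F i x).
Proof.
move=> cF; elim: r => [|i r IH].
  by under eq_fun do rewrite big_nil; exact: cst_continuous.
under eq_fun do rewrite big_cons.
exact: continuous_addC.
Qed.

Lemma continuous_prodC I (r : seq I) (F : I -> T -> R[i]) :
  (forall i, continuous (F i)) -> continuous (fun x => \prod_(i <- r) F i x).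
Proof.
move=> cF; elim: r => [|i r IH].
  by under eq_fun do rewrite big_nil; exact: cst_continuous.
under eq_fun do rewrite big_cons.
exact: continuous_mulC.
Qed.

Lemma continuous_mulmx p q r (f : T -> 'M[R[i]]_(p, q))
    (g : T -> 'M[R[i]]_(q, r)) :
  continuous f -> continuous g -> continuous (fun x => f x *m g x).
Proof.
move=> cf cg; apply: continuous_mx => i j; under eq_fun do rewrite mxE.
by apply: continuous_sumC => k; apply: continuous_mulC; apply: continuous_entry.
Qed.

Lemma continuous_det p (f : T -> 'M[R[i]]_p) :
  continuous f -> continuous (fun x => \det (f x)).
Proof.
move=> cf; apply: continuous_sumC => s; apply: continuous_mulC.
  exact: cst_continuous.
by apply: continuous_prodC => k; apply: continuous_entry.
Qed.

Lemma continuous_invmx p (f : T -> 'M[R[i]]_p) :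
  (forall x, f x \in unitmx) -> continuous f ->
  continuous (fun x => invmx (f x)).
Proof.
move=> fU cf; apply: continuous_mx => i j.
under eq_fun => x do rewrite /invmx fU !mxE.
apply: continuous_mulC => [x|].
  apply: (@cvgV R[i]); last exact: continuous_det.
  by rewrite -unitfE -unitmxE.
apply: continuous_mulC; first exact: cst_continuous.
apply: continuous_det; apply: continuous_mx => k l.
under eq_fun do rewrite !mxE.
exact: continuous_entry.
Qed.

End ContinuousMatrices.

Lemma homog_continuous (R : realType) n d (f : 'rV[R[i]]_n -> R[i]) :
  homog d f -> continuous f.
Proof.
elim=> {d f} [c|d a f _ IH|d f g _ IHf _ IHg|d f g _ IH /funext <-//].
- exact: cst_continuous.
- have ca : continuous (fun v : 'rV[R[i]]_n => v *m a).
    by apply: continuous_mulmx; [move=> ?; exact: cvg_id|exact: cst_continuous].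
  exact: (continuous_mulC (continuous_entry (i := 0) (j := 0) ca) IH).
- exact: continuous_addC.
Qed.

(** * The quotient bundle *)

Section Bundle.
Context (R : realType) (gT : finGroupType) (W : {group gT}) (n m : nat).
Variables (rV : mx_representation R[i] W n) (rU : mx_representation R[i] W m).
Local Notation X := (arrangement_complement rV).

Lemma arrangement_complementP x :
  X x <-> forall s, s \in reflections rV -> x *m rV s != x.
Proof.
split=> [Xx s sR|Xx [_ [s sR <-]] /= xs]; last by have /eqP := Xx s sR.
by apply/eqP => xs; apply: Xx; exists [set v | v *m rV s = v] => //; exists s.
Qed.

Lemma reflections_conj s w :
  s \in reflections rV -> w \in W -> (s ^ w)%g \in reflections rV.
Proof.
rewrite !finset.inE.
case/andP=> Ws rk Ww.
rewrite (groupJ Ws Ww).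
rewrite andTb.
have E : rV (s ^ w)%g - 1%:M = rV w^-1%g *m (rV s - 1%:M) *m rV w.
  rewrite mulmxBr mulmx1 mulmxBl conjgE.
  rewrite (repr_mxM _ (groupVr Ww) (groupM Ws Ww)) (repr_mxM _ Ws Ww) mulmxA.
  by rewrite -(repr_mxM _ (groupVr Ww) Ww) mulVg repr_mx1.
rewrite /eigenspace E.
rewrite mxrank_ker mxrankMfree ?row_free_unit ?repr_mx_unit//.
rewrite (eqmxMfull _ (_ : row_full _)) ?row_full_unit ?repr_mx_unit ?groupV//.
by rewrite -mxrank_ker.
Qed.

Lemma arrangement_complement_act x w : w \in W -> X x -> X (x *m rV w).
Proof.
move=> Ww /arrangement_complementP Xx; apply/arrangement_complementP => s sR.
have Ws : s \in W by move: sR; rewrite finset.inE => /andP[].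
have := Xx _ (reflections_conj sR (groupVr Ww)); apply: contra => /eqP xws.
apply/eqP; rewrite conjgE invgK !repr_mxM ?groupM ?groupV// !mulmxA.
by rewrite xws repr_mxK.
Qed.

Lemma base_class_eqP (x y : X) : base_class x = base_class y <->
  exists2 w, w \in W & \val x *m rV w = \val y.
Proof.
rewrite /base_class; split=> [|[w Ww e]].
  move/(@eqP {eq_quot (base_equiv rV)}); rewrite eqmodE.
  by case/existsP=> w /andP[Ww /eqP e]; exists w.
apply/(@eqP {eq_quot (base_equiv rV)}); rewrite eqmodE.
by apply/existsP; exists w; rewrite Ww e eqxx.
Qed.

Lemma total_class_act (x y : X) u w : w \in W -> \val x *m rV w = \val y ->
  total_class rU x u = total_class rU y (u *m rU w).
Proof.
move=> Ww e; rewrite /total_class; apply/(@eqP {eq_quot (total_equiv rV rU)}).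
rewrite eqmodE.
by apply/existsP; exists w; rewrite Ww /= e !eqxx.
Qed.

(** The saturation of an open set is the union of its translates. *)
Lemma base_class_open (A : set X) :
  open A -> open (@base_class R gT W n rV @` A).
Proof.
case=> O oO OA.
rewrite /open/= /quotient_open.
have -> : \pi_{eq_quot (base_equiv rV)} @^-1` (@base_class R gT W n rV @` A) =
   set_val @^-1`
     (\bigcup_(w in [set` W]) ((fun v => v *m rV w) @^-1` O)) :> set X.
  apply/seteqP; split=> [y [x]|y [w Ww Oyw]] /=.
    rewrite -OA => Ox /base_class_eqP[w Ww e].
    exists w^-1%g; first by rewrite /= groupV.
    by rewrite /= -[set_val y]/(\val y) -e repr_mxK.
  have Xyw : set_val y *m rV w \in X.
    by apply/mem_set/arrangement_complement_act => //; apply: set_valP.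
  exists (@exist _ (fun x => x \in X) _ Xyw); first by rewrite -OA.
  apply/base_class_eqP; exists w^-1%g; rewrite ?groupV//=.
  by rewrite repr_mxK.
exists (\bigcup_(w in [set` W]) ((fun v => v *m rV w) @^-1` O)) => //.
apply: bigcup_open => w _; apply: open_comp => // v _.
by apply: continuous_mulmx; [move=> ?; exact: cvg_id|exact: cst_continuous].
Qed.

Lemma base_classW (b : base_space rV) : exists x, b = base_class x.
Proof.
by exists (repr (b : {eq_quot (base_equiv rV)})); rewrite /base_class reprK.
Qed.

Lemma total_classW (q : total_space rV rU) : exists x u, q = total_class rU x u.
Proof.
exists (repr (q : {eq_quot (total_equiv rV rU)})).1.
exists (repr (q : {eq_quot (total_equiv rV rU)})).2.
by rewrite /total_class -surjective_pairing reprK.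
Qed.

(** In the frame [P x] the coordinates of [[x, u]] depend only on its class, by
    equivariance. The inverse is continuous on the product of the base with the
    vector space because the projection onto the base is open. *)
Lemma KZ_bundle_trivial_of_frame (P : 'rV[R[i]]_n -> 'M[R[i]]_m) :
    continuous P ->
    (forall w v, w \in W -> P (v *m rV w) = P v *m rU w) ->
    (forall x, X x -> P x \in unitmx) ->
  KZ_bundle_trivial rV rU.
Proof.
move=> cP PE PU.
have valU (x : X) : P (\val x) \in unitmx by apply/PU/set_valP.
pose fib (p : X * 'rV[R[i]]_m) := p.2 *m invmx (P (\val p.1)).
pose Phi (q : total_space rV rU) :=
  (bundle_proj q, fib (repr (q : {eq_quot (total_equiv rV rU)}))).
pose Psi (p : base_space rV * 'rV[R[i]]_m) : total_space rV rU :=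
  let x := repr (p.1 : {eq_quot (base_equiv rV)}) in
  total_class rU x (p.2 *m P (\val x)).
have PhiE x u :
    Phi (total_class rU x u) = (base_class x, u *m invmx (P (\val x))).
  rewrite /Phi bundle_projE; congr (_, _); rewrite /total_class.
  case: piP => -[y v] /eqP; rewrite eqmodE => /existsP[w /andP[Ww]].
  move=> /andP[/eqP/= e /eqP/= <-]; rewrite /fib /= -e PE// -!mulmxA.
  congr (_ *m _); rewrite -[LHS]mul1mx -{1}(mulVmx (valU x)) -mulmxA.
  by rewrite [P _ *m _]mulmxA mulmxV ?mulmx1// unitmx_mul valU repr_mx_unit.
have PsiE x u : Psi (base_class x, u) = total_class rU x (u *m P (\val x)).
  rewrite /Psi /=; have : base_class x =
      base_class (repr (base_class x : {eq_quot (base_equiv rV)})).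
    by rewrite {2}/base_class reprK.
  move/base_class_eqP => [w Ww e].
  by rewrite (total_class_act _ Ww e) -e PE// mulmxA.
have cval : continuous (fun p : X * 'rV[R[i]]_m => P (\val p.1)).
  move=> p; apply: continuous_comp; last exact: cP.
  apply: continuous_comp; first exact: cvg_fst.
  exact: initial_continuous.
have cfib : continuous fib.
  apply: (@continuous_mulmx _ _ _ _ _ (fun p : X * 'rV[R[i]]_m => p.2)).
    by move=> ?; exact: cvg_snd.
  exact: continuous_invmx.
have cbase : continuous (fun p : X * 'rV[R[i]]_m => base_class p.1).
  move=> p; apply: (@continuous_comp _ _ _ fst (@base_class R gT W n rV)).
    exact: cvg_fst.
  exact: pi_continuous.
have ctotal : continuous (fun p : X * 'rV[R[i]]_m =>
    total_class rU p.1 (p.2 *m P (\val p.1))).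
  have cpair :
      continuous (fun p : X * 'rV[R[i]]_m => (p.1, p.2 *m P (\val p.1))).
    have cmul : continuous (fun p : X * 'rV[R[i]]_m => p.2 *m P (\val p.1)).
      apply: (@continuous_mulmx _ _ _ _ _ (fun p : X * 'rV[R[i]]_m => p.2));
        last exact: cval.
      by move=> ?; exact: cvg_snd.
    have cfst : continuous (fun p : X * 'rV[R[i]]_m => p.1).
      by move=> p; exact: cvg_fst.
    by move=> p; exact: (cvg_pair (cfst p) (cmul p)).
  pose tpi (q : X * 'rV[R[i]]_m) : total_space rV rU :=
    \pi_{eq_quot (total_equiv rV rU)} q.
  move=> p; apply: (@continuous_comp _ _ _
    (fun p : X * 'rV[R[i]]_m => (p.1, p.2 *m P (\val p.1))) tpi).
    exact: cpair.
  exact: pi_continuous.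
exists Phi, Psi; split=> [|||x a u v].
- split.
    apply/quotient_continuous => p.
    have -> : Phi \o \pi_(quotient_topology {eq_quot (total_equiv rV rU)}) =
        (fun p => (base_class p.1, fib p)).
      by apply/funext => -[x u]; apply: PhiE.
    exact: (cvg_pair (cbase p) (cfib p)).
  move=> [b u]; have [x ->] := base_classW b => N.
  rewrite PsiE => Nx; have [[A B] /= [Ax Bu] AB] := ctotal (x, u) N Nx.
  exists (@base_class R gT W n rV @` A°, B) => /=; first split=> //.
    apply: (@open_nbhs_nbhs (base_space rV)); split; last by exists x.
    exact/base_class_open/open_interior.
  move=> [b' t] /= [[y /interior_subset Ay <-] Bt].
  by rewrite /= PsiE; apply: (AB (y, t)).
- split=> [q|[b u]].
    by have [x [u ->]] := total_classW q; rewrite PhiE PsiE mulmxKV.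
  by have [x ->] := base_classW b; rewrite PsiE PhiE mulmxK.
- by [].
- by rewrite !PhiE /= mulmxDl scalemxAl.
Qed.

End Bundle.

End EquivariantFrames.

Theorem theorem1p3 (R : realType) (gT : finGroupType) (W : {group gT})
    (n : nat) (rV : mx_representation R[i] W n)
    (reflW : irreducible_reflection_group rV)
    (hW : n = 2 \/
      (has_cartan_matrix rV (cartan_G23 R[i]) \/
       has_cartan_matrix rV (cartan_G24 R[i]) \/
       has_cartan_matrix rV (cartan_G25 R[i]) \/
       has_cartan_matrix rV (cartan_G26 R[i]) \/
       has_cartan_matrix rV (cartan_G30 R[i]) \/
       has_cartan_matrix rV (cartan_G32 R[i]) \/
       has_cartan_matrix rV (cartan_G33 R[i]) \/
       has_cartan_matrix rV (cartan_G35 R[i])))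
    (m : nat) (rU : mx_representation R[i] W m) :
  KZ_bundle_trivial rV rU.
Proof.
case: reflW => faithV genW _.
have [P [hP PE PU]] := equivariant_frame rU faithV genW.
apply: (@KZ_bundle_trivial_of_frame _ _ _ _ _ rV rU P _ PE).
  by apply: continuous_mx => i j; have [d /homog_continuous] := hP i j.
by move=> x /arrangement_complementP; apply: PU.
Qed.
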